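(* Let $p,q,\ell,n$ be positive integers with $p\le q\le\ell$. Let $N(p,q,\ell,n)$ denote the number of ordered triples $(x,y,z)$ of nonnegative integers with $px+qy+\ell z=n$. Let $u=\gcd(p,q)$ and $A=\{p/u,q/u\}$. For each integer $z$ with $0\le z\le\lfloor n/\ell\rfloor$ and $u\mid (n-z\ell)$, let $a_1(z)$ and $b_1(z)$ be the smallest nonnegative integers satisfying \[ p\,a_1(z)\equiv n-z\ell \pmod q\qquad\text{and}\qquad q\,b_1(z)\equiv n-z\ell\pmod p, \] and let \[ M(z)=\max\Big\{-1,\ \frac{u}{pq}\big(n-z\ell-p\,a_1(z)-q\,b_1(z)\big)\Big\}. \] Then \[ N(p,q,\ell,n)=\sum_{\substack{0\le z\le\lfloor n/\ell\rfloor\\ u\mid (n-z\ell)}} p_A\!\left(\frac{n-z\ell}{u}\right)=\sum_{\substack{0\le z\le\lfloor n/\ell\rfloor\\ u\mid (n-z\ell)}}\big(1+M(z)\big). \] Furthermore, the set of all nonnegative integer solutions $(x,y,z)$ of $px+qy+\ell z=n$ is the union, over all $z$ with $0\le z\le \lfloor n/\ell\rfloor$ and $u\mid(n-z\ell)$, of the sets \[ \left\{\left(\frac{q}{u}\,i+a_1(z),\ (M(z)-i)\frac{p}{u}+b_1(z),\ z\right):\ i\in\mathbb{Z},\ 0\le i\le M(z)\right\}, \] where for those $z$ with $n-z\ell-p\,a_1(z)-q\,b_1(z)<0$ there are no nonnegative solutions with that value of $z$ (the corresponding set is empty).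
   Context: For a set $A=\{a,b\}$ of relatively prime positive integers and an integer $m\ge0$, $p_A(m)$ denotes the number of partitions of $m$ with all parts in $A$, i.e. the number of pairs $(x,y)$ of nonnegative integers with $ax+by=m$. *)

(* Defs.v *)
From HB Require Import structures.
From mathcomp Require Import all_boot all_order all_algebra finmap.
From mathcomp Require Import boolp classical_sets cardinality.

Set Implicit Arguments.
Unset Strict Implicit.
Unset Printing Implicit Defensive.

Import Order.TTheory GRing.Theory Num.Theory.

Local Open Scope nat_scope.
Local Open Scope classical_set_scope.

Definition solutions2 (a b m : nat) : set (nat * nat) :=
  [set t | a * t.1 + b * t.2 = m].

(* [fset_set] is empty on infinite sets; see [finite_solutions2] and
   [finite_solutions3] for the finiteness of the sets counted below. *)
Definition pA (a b m : nat) : nat := #|` fset_set (solutions2 a b m)|%fset.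

Definition solutions3 (p q l n : nat) : set (nat * nat * nat) :=
  [set t | p * t.1.1 + q * t.1.2 + l * t.2 = n].

Definition Nsol (p q l n : nat) : nat := #|` fset_set (solutions3 p q l n)|%fset.

(* Meaningful only if [P] is inhabited (see [least_congP]); 0 otherwise. *)
Definition least (P : pred nat) : nat :=
  if pselect (exists a, P a) is left exP then ex_minn exP else 0.

(* [n - z * l] does not truncate on this set. *)
Definition zrange (p q l n : nat) : set nat :=
  [set z | z <= n %/ l /\ gcdn p q %| n - z * l].

Definition a1 (p q l n z : nat) : nat :=
  least (fun a => p * a == n - z * l %[mod q]).

Definition b1 (p q l n z : nat) : nat :=
  least (fun b => q * b == n - z * l %[mod p]).

Local Open Scope ring_scope.

Definition residue (p q l n z : nat) : rat :=
  n%:R - z%:R * l%:R - p%:R * (a1 p q l n z)%:R - q%:R * (b1 p q l n z)%:R.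

Definition Mz (p q l n z : nat) : rat :=
  Num.max (-1) ((gcdn p q)%:R / (p%:R * q%:R) * residue p q l n z).

Definition sol_family (p q l n z : nat) : set (rat * rat * rat) :=
  [set (q%:R / (gcdn p q)%:R * i%:~R + (a1 p q l n z)%:R,
        (Mz p q l n z - i%:~R) * (p%:R / (gcdn p q)%:R) + (b1 p q l n z)%:R,
        z%:R)
  | i in [set i : int | 0 <= i%:~R :> rat /\ i%:~R <= Mz p q l n z]].

(* [sol_family] is not known a priori to consist of integer points, so it is
   compared with the solutions inside Q^3. *)
Definition rat3 (t : nat * nat * nat) : rat * rat * rat :=
  (t.1.1%:R, t.1.2%:R, t.2%:R).

Local Close Scope ring_scope.

Lemma finite_solutions2 a b m :
  0 < a -> 0 < b -> finite_set (solutions2 a b m).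
Proof.
move=> a0 b0; apply: (@sub_finite_set _ _ (`I_m.+1 `*` `I_m.+1)).
  move=> [x y] /= <-; split => /=; rewrite ltnS.
    by rewrite (leq_trans (leq_pmull x a0)) // leq_addr.
  by rewrite (leq_trans (leq_pmull y b0)) // leq_addl.
by apply: finite_setX.
Qed.

Lemma finite_solutions3 p q l n :
  0 < p -> 0 < q -> 0 < l -> finite_set (solutions3 p q l n).
Proof.
move=> p0 q0 l0; apply: (@sub_finite_set _ _ (`I_n.+1 `*` `I_n.+1 `*` `I_n.+1)).
  move=> [[x y] z] /= <-; split => /=; [split => /=|]; rewrite ltnS.
  - by rewrite (leq_trans (leq_pmull x p0)) // -addnA leq_addr.
  - by rewrite (leq_trans (leq_pmull y q0)) // addnAC leq_addl.
  - by rewrite (leq_trans (leq_pmull z l0)) // leq_addl.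
by apply: finite_setX => //; apply: finite_setX.
Qed.

Lemma least_congP p q m : 0 < p -> gcdn p q %| m ->
  let P a := p * a == m %[mod q] in
  P (least P) /\ forall a, P a -> least P <= a.
Proof.
move=> p0 /dvdnP[k mE] P; rewrite /least; case: pselect => [exP|]; last first.
  case; have [x y xE _] := egcdnP q p0; exists (x * k).
  by rewrite /P mulnA (mulnC p) xE mulnDl (mulnC _ k) mE mulnA modnMDl mulnC.
by case: ex_minnP.
Qed.

(* Main.v *)
(** Fix [z] and put [m = n - z l], [u = gcd(p, q)].  If [u] divides [m], the
    nonnegative [x] with [p x = m] modulo [q] are exactly
    [a1 + (q / u) i] with [i >= 0], and symmetrically
    [y = b1 + (p / u) j] with [j >= 0].  Substituting, [p x + q y = m] becomes
    [(i + j) lcm(p, q) = m - p a1 - q b1].  The right-hand side is a multiple of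
    [lcm(p, q)], and it exceeds [- 2 lcm(p, q)] since [a1 < q / u] and
    [b1 < p / u]; so its quotient is an integer [M >= -1], and the solutions
    correspond to the [1 + M] pairs [(i, j)] with [i + j = M]. *)

Require Import Defs.
From HB Require Import structures.
From mathcomp Require Import all_boot all_order all_algebra finmap.
From mathcomp Require Import boolp classical_sets cardinality.
From mathcomp Require Import ring lra.

Set Implicit Arguments.
Unset Strict Implicit.
Unset Printing Implicit Defensive.

Import Order.TTheory GRing.Theory Num.Theory.

Local Open Scope classical_set_scope.
Local Open Scope ring_scope.

(** * Enumeration by lists, and least solutions of linear congruences *)

Local Notation least_cong p q m := (least (fun a => p * a == m %[mod q])%N).

Lemma card_fset_set_seq (T : choiceType) (S : set T) (s : seq T) :
  uniq s -> (forall x, S x <-> x \in s) -> #|` fset_set S|%fset = size s.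
Proof.
move=> us Ss; have -> : S = [set` s] by apply/seteqP; split=> x /= /Ss.
have -> : fset_set [set` s] = [fset x in s]%fset.
  by apply/fsetP => x; rewrite in_fset_set // !inE; apply/idP/idP; rewrite inE.
by rewrite card_fseq undup_id.
Qed.

(** Since [p * (q %/ u)] is a multiple of [q], where [u = gcdn p q], reducing a solution modulo
    [q %/ u] gives another solution; minimality then bounds the least one. *)
Lemma least_cong_lt (p q m : nat) : (0 < p)%N -> (0 < q)%N ->
  (gcdn p q %| m)%N -> (least_cong p q m < q %/ gcdn p q)%N.
Proof.
move=> p0 q0 um; have [rE rmin] := least_congP p0 um.
have u0 : (0 < gcdn p q)%N by rewrite gcdn_gt0 p0.
have Q0 : (0 < q %/ gcdn p q)%N by rewrite divn_gt0 // dvdn_leq // dvdn_gcdr.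
set r := least _ in rE rmin *.
apply: leq_ltn_trans (ltn_pmod r Q0); apply: rmin.
rewrite -(eqP rE) {2}(divn_eq r (q %/ gcdn p q)) mulnDr.
by rewrite mulnCA muln_divCA_gcd mulnCA (mulnC q) modnMDl.
Qed.

Lemma least_cong_coset (p q m x : nat) : (0 < p)%N -> (0 < q)%N ->
  (gcdn p q %| m)%N -> (p * x = m %[mod q])%N ->
  exists i, x = (least_cong p q m + q %/ gcdn p q * i)%N.
Proof.
move=> p0 q0 um xE; have [rE rmin] := least_congP p0 um.
have u0 : (0 < gcdn p q)%N by rewrite gcdn_gt0 p0.
have rx : (least_cong p q m <= x)%N by apply: rmin; rewrite xE.
set r := least _ in rE rmin rx *.
set u := gcdn p q in u0 *.
have : (q %/ u * u %| p %/ u * u * (x - r))%N.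
  rewrite !divnK ?dvdn_gcdl ?dvdn_gcdr //.
  by rewrite mulnBr -eqn_mod_dvd ?leq_mul2l ?rx ?orbT // xE eq_sym; exact: rE.
(* From [q] dividing [p * (x - r)], cancel [u]: as [q %/ u] and [p %/ u] are coprime, [q %/ u]
   divides [x - r]. *)
rewrite mulnAC dvdn_pmul2r // Gauss_dvdr; last first.
  rewrite /coprime -(eqn_pmul2r u0) mul1n muln_gcdl.
  by rewrite !divnK ?dvdn_gcdl ?dvdn_gcdr // gcdnC.
by case/dvdnP => i iE; exists i; rewrite mulnC -iE subnKC.
Qed.

(** * The equation in two variables with fixed right-hand side *)

Section TwoVariables.
Variables p q m : nat.
Hypotheses (p0 : (0 < p)%N) (q0 : (0 < q)%N) (um : (gcdn p q %| m)%N).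

Let u := gcdn p q.
(** For [m = n - z * l], these two values are [a1] and [b1]. *)
Let a := least_cong p q m.
Let b := least_cong q p m.
Let L := (p * (q %/ u))%N.

Let qpu : (q * (p %/ u))%N = L.
Proof. by rewrite /L /u muln_divCA_gcd. Qed.

(* [k] is the number of solutions, i.e. [1 + M(z)] in the paper; the equation
   says [m - p a - q b = (k - 1) lcm(p, q)] without subtraction.  The bounds
   [a < q / u] and [b < p / u] make the left-hand side at least
   [- lcm(p, q)]. *)
Lemma two_variables_excess : exists k, (p * a + q * b + k * L = m + L)%N.
Proof.
have um' : (gcdn q p %| m)%N by rewrite gcdnC.
have [/eqP aE _] := least_congP p0 um; have [/eqP bE _] := least_congP q0 um'.
have aQ := least_cong_lt p0 q0 um; have bP := least_cong_lt q0 p0 um'.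
rewrite -/a -/u in aE aQ; rewrite -/b gcdnC -/u in bE bP.
have pE : (p * a + q * b = m %[mod p])%N by rewrite (mulnC p) modnMDl.
have qE : (p * a + q * b = m %[mod q])%N by rewrite addnC (mulnC q) modnMDl.
have LE : lcmn p q = L by rewrite /L /u muln_divA ?dvdn_gcdr.
have lt2 : (p * a + q * b < L + L)%N.
  have aL : (p * a <= L)%N by rewrite leq_mul2l (ltnW aQ) orbT.
  have bL : (q * b < L)%N by rewrite -qpu ltn_mul2l q0.
  by rewrite -addnS leq_add.
have [le|le] := leqP (p * a + q * b) m.
- have : (L %| m - (p * a + q * b))%N.
    by rewrite -LE dvdn_lcm -!eqn_mod_dvd // pE qE !eqxx.
  case/dvdnP => t tE; exists t.+1.
  by rewrite mulSn addnCA -tE subnKC // addnC.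
- have : (L %| p * a + q * b - m)%N.
    by rewrite -LE dvdn_lcm -!eqn_mod_dvd ?(ltnW le) // pE qE !eqxx.
  (* The quotient is nonzero because [m < p * a + q * b], and below 2 by [lt2]. The remaining value
     1 gives [k = 0], the case without solutions. *)
  case/dvdnP => -[|[|t]] tE.
  + by move: le; rewrite -subn_gt0 tE.
  + by exists 0%N; rewrite addn0 -(subnKC (ltnW le)) tE mul1n.
  + move: lt2; rewrite ltnNge (leq_trans _ (leq_subr m _)) // tE.
    by rewrite !mulSn addnA leq_addr.
Qed.

Lemma two_variables_solutions k : (p * a + q * b + k * L = m + L)%N ->
  forall x y, (p * x + q * y = m)%N <->
    exists2 i, (i < k)%N &
      (x, y) = (a + q %/ u * i, b + p %/ u * (k.-1 - i))%N.
Proof.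
move=> kE x y; have um' : (gcdn q p %| m)%N by rewrite gcdnC.
have L0 : (0 < L)%N.
  by rewrite muln_gt0 p0 divn_gt0 ?gcdn_gt0 ?p0 // dvdn_leq // dvdn_gcdr.
have expand i j : (p * (a + q %/ u * i) + q * (b + p %/ u * j)
    = p * a + q * b + (i + j) * L)%N.
  by rewrite !mulnDr (mulnA p) (mulnA q) qpu -/L !(mulnC L) addnACA mulnDl.
split=> [xyE|[i ik [-> ->]]]; last first.
  case: k kE ik => // k kE ik; rewrite expand subnKC //.
  by move: kE; rewrite mulSn addnCA addnC => /addIn.
have [i xi] : exists i, x = (a + q %/ u * i)%N.
  by apply: least_cong_coset; rewrite // -xyE [in RHS]addnC (mulnC q) modnMDl.
have [j yj] : exists j, y = (b + p %/ u * j)%N.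
  rewrite /u gcdnC; apply: least_cong_coset => //.
  by rewrite -xyE (mulnC p) modnMDl.
(* Comparing [expand] with [kE] and cancelling [L] fixes the sum [i + j], so [i] alone determines
   the solution. *)
have ijk : k = (i + j).+1.
  apply/eqP; rewrite -(eqn_pmul2r L0); apply/eqP.
  move: kE; rewrite -xyE xi yj expand -(addnA (p * a + q * b)%N).
  by move=> /addnI ->; rewrite mulSn addnC.
by exists i; rewrite ijk /= ?xi ?yj ?addKn // ltnS leq_addr.
Qed.

Lemma pA_excess k : (p * a + q * b + k * L = m + L)%N -> pA p q m = k.
Proof.
move=> kE; have sE := two_variables_solutions kE.
have Q0 : (0 < q %/ u)%N.
  by rewrite divn_gt0 ?gcdn_gt0 ?p0 // dvdn_leq // dvdn_gcdr.
pose f i := (a + q %/ u * i, b + p %/ u * (k.-1 - i))%N.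
rewrite /pA (@card_fset_set_seq _ _ (map f (iota 0 k))).
- by rewrite size_map size_iota.
- rewrite map_inj_uniq ?iota_uniq // => i j [/addnI/eqP + _].
  by rewrite eqn_pmul2l // => /eqP.
- move=> [x y]; split=> [/sE [i ik ->]|/mapP[i]].
    by apply/mapP; exists i; rewrite // mem_iota.
  by rewrite mem_iota => /= ik fE; apply/sE; exists i.
Qed.

Lemma pA_div_gcd : pA (p %/ u) (q %/ u) (m %/ u) = pA p q m.
Proof.
rewrite /pA; congr (#|` fset_set _|%fset); apply/seteqP.
have u0 : (0 < u)%N by rewrite gcdn_gt0 p0.
suff E x y : (p %/ u * x + q %/ u * y == m %/ u)%N = (p * x + q * y == m)%N.
  by split=> -[x y] /eqP xyE; apply/eqP; [rewrite /= -E|rewrite /= E].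
rewrite -(eqn_pmul2r u0) mulnDl !(mulnAC _ _ u) !divnK //.
  exact: dvdn_gcdr.
exact: dvdn_gcdl.
Qed.

End TwoVariables.

(** * Slicing the three-variable solution set by [z] *)

Lemma solutions3_slice (p q l n x y z : nat) : (0 < l)%N ->
  solutions3 p q l n (x, y, z) <->
  zrange p q l n z /\ solutions2 p q (n - z * l) (x, y).
Proof.
move=> l0; rewrite /solutions3 /zrange /solutions2 /=; split.
  move=> <-; rewrite leq_divRL // (mulnC l) leq_addl addnK; split=> //; split=> //.
  by rewrite dvdn_add // dvdn_mulr // ?dvdn_gcdl ?dvdn_gcdr.
by move=> [[zn _] ->]; rewrite (mulnC l) subnK // -leq_divRL.
Qed.

Lemma Nsol_slices (p q l n : nat) : (0 < p)%N -> (0 < q)%N -> (0 < l)%N ->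
  Nsol p q l n = (\sum_(0 <= z < (n %/ l).+1 | gcdn p q %| n - z * l)
                    pA p q (n - z * l))%N.
Proof.
move=> p0 q0 l0.
pose zs := [seq z <- index_iota 0 (n %/ l).+1 | (gcdn p q %| n - z * l)%N].
pose slice z : seq (nat * nat) :=
  enum_fset (fset_set (solutions2 p q (n - z * l))).
(* The slices are concatenated; no triple repeats, since [z] is recorded in it and each slice is
   duplicate-free. *)
rewrite /Nsol (@card_fset_set_seq _ _ [seq (t, z) | z <- zs, t <- slice z]).
- by rewrite size_allpairs_dep sumnE big_map big_filter.
- apply: allpairs_uniq_dep.
  + by rewrite filter_uniq // iota_uniq.
  + by move=> z _; exact: fset_uniq.
  + by move=> [z t] [z' t'] _ _ /= [-> ->].
- move=> [[x y] z]; rewrite solutions3_slice //.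
  have mem_zs : (z \in zs) <-> zrange p q l n z.
    by rewrite mem_filter mem_index_iota /= ltnS; split=> [/andP[]|[-> ->]].
  have mem_slice z' t : (t \in slice z') <-> solutions2 p q (n - z' * l) t.
    have fin := finite_solutions2 (n - z' * l) p0 q0.
    by rewrite [t \in slice z'](in_fset_set fin); split; rewrite inE.
  split=> [[/mem_zs zz /mem_slice tz]|].
    by apply/allpairsPdep; exists z, (x, y).
  case/allpairsPdep => z' [t [zz tz [tE zE]]]; subst z'; rewrite -tE in tz.
  by split; [apply/mem_zs|apply/mem_slice].
Qed.

(** * One slice in rational coordinates *)

Section Slice.
Variables p q l n z k : nat.
Hypotheses (p0 : (0 < p)%N) (q0 : (0 < q)%N) (l0 : (0 < l)%N).
Hypothesis zr : zrange p q l n z.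

Let u := gcdn p q.
Let a := a1 p q l n z.
Let b := b1 p q l n z.

Hypothesis kE :
  (p * a + q * b + k * (p * (q %/ u)) = n - z * l + p * (q %/ u))%N.

Let u_neq0 : u%:R != 0 :> rat.
Proof. by rewrite pnatr_eq0 -lt0n gcdn_gt0 p0. Qed.

Let p_neq0 : p%:R != 0 :> rat. Proof. by rewrite pnatr_eq0 -lt0n. Qed.

Let q_neq0 : q%:R != 0 :> rat. Proof. by rewrite pnatr_eq0 -lt0n. Qed.

Let divu (c : nat) : (u %| c)%N -> c%:R / u%:R = (c %/ u)%:R :> rat.
Proof. by move=> uc; rewrite -{1}(divnK uc) natrM mulfK. Qed.

Let quE : q%:R / u%:R = (q %/ u)%:R :> rat.
Proof. by rewrite divu // dvdn_gcdr. Qed.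

Let puE : p%:R / u%:R = (p %/ u)%:R :> rat.
Proof. by rewrite divu // dvdn_gcdl. Qed.

Lemma residue_excess :
  residue p q l n z = (k%:R - 1) * (p%:R * (q%:R / u%:R)).
Proof.
have [zn _] := zr; rewrite leq_divRL // in zn.
rewrite /residue -/a -/b -natrM -natrB //.
have := congr1 (GRing.natmul (1 : rat)) kE.
by rewrite quE !natrD !natrM => E; lra.
Qed.

(** As [k] is a natural number, [k - 1] is at least [-1], so the maximum always equals its second
    argument. *)
Lemma Mz_excess : Mz p q l n z = k%:R - 1.
Proof.
rewrite /Mz residue_excess -/u.
have -> : u%:R / (p%:R * q%:R) * ((k%:R - 1) * (p%:R * (q%:R / u%:R)))
    = k%:R - 1 :> rat by field; rewrite u_neq0 p_neq0 q_neq0.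
by apply/max_idPr; rewrite -[leLHS]add0r lerD2r.
Qed.

Lemma sol_family_slice : sol_family p q l n z =
  rat3 @` [set t | solutions2 p q (n - z * l) t.1 /\ t.2 = z].
Proof.
have sE := two_variables_solutions p0 q0 (proj2 zr) kE.
rewrite /sol_family Mz_excess quE puE -/a -/b.
have point (i : nat) : (i < k)%N -> (k%:R - 1 - i%:R = (k.-1 - i)%:R :> rat).
  move=> ik; have k0 := leq_ltn_trans (leq0n i) ik.
  have ik1 : (i <= k.-1)%N by rewrite -ltnS prednK.
  have -> : k%:R = k.-1%:R + 1 :> rat by rewrite natr1 prednK.
  by rewrite addrK natrB.
apply/seteqP; split=> [_ [i [i0 ik] <-]|].
  (* Negative integers are excluded by [i0]; for a natural [i], the bound [i <= k - 1] in the
     rationals becomes [i < k]. *)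
  case: i i0 ik => [i|i]; last by rewrite NegzE ler0z.
  move=> _; rewrite -pmulrn lerBrDr natr1 ler_nat => ik.
  exists (a + q %/ u * i, b + p %/ u * (k.-1 - i), z)%N.
    by split=> //=; apply/sE; exists i.
  by rewrite /rat3 /= point // !natrD !natrM; congr (_, _, _); ring.
move=> _ [[[x y] z'] /= [/sE[i ik [-> ->]] ->] <-]; exists i%:Z.
  by rewrite /= -pmulrn ler0n lerBrDr natr1 ler_nat.
by rewrite /rat3 /= -pmulrn point // !natrD !natrM; congr (_, _, _); ring.
Qed.

(** The residue has the sign of [k - 1], so a negative one forces [k = 0], leaving no index
    [i < k]. *)
Lemma solutions2_residue_lt0 : residue p q l n z < 0 ->
  forall x y, ~ solutions2 p q (n - z * l) (x, y).
Proof.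
have k0 : residue p q l n z < 0 -> k = 0%N.
  rewrite residue_excess pmulr_llt0; last first.
    by rewrite mulr_gt0 ?divr_gt0 ?ltr0n // gcdn_gt0 p0.
  by rewrite subr_lt0 ltrn1; case: (k).
have sE := two_variables_solutions p0 q0 (proj2 zr) kE.
by move=> /k0 k0' x y /sE[i]; rewrite k0'.
Qed.

End Slice.

(** * Assembling the slices over all admissible [z] *)

Theorem theorem2p2 (p q l n : nat)
  (hp : (0 < p)%N) (hq : (0 < q)%N) (hl : (0 < l)%N) (hn : (0 < n)%N)
  (hpq : (p <= q)%N) (hql : (q <= l)%N) :
  let u := gcdn p q in
  [/\ Nsol p q l n =
        (\sum_(0 <= z < (n %/ l).+1 | u %| n - z * l)
           pA (p %/ u) (q %/ u) ((n - z * l) %/ u))%N,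
      (Nsol p q l n)%:R =
        \sum_(0 <= z < (n %/ l).+1 | (u %| n - z * l)%N)
           (1 + Mz p q l n z),
      rat3 @` solutions3 p q l n =
        \bigcup_(z in zrange p q l n) sol_family p q l n z
    & forall z : nat, zrange p q l n z -> residue p q l n z < 0 ->
        (forall x y : nat, ~ solutions3 p q l n (x, y, z)) /\
        sol_family p q l n z = set0].
Proof.
move=> u; have NE := Nsol_slices n hp hq hl.
have slice z : zrange p q l n z -> sol_family p q l n z =
    rat3 @` [set t | solutions2 p q (n - z * l) t.1 /\ t.2 = z].
  move=> zr; have [k kE] := two_variables_excess hp hq (proj2 zr).
  exact: (sol_family_slice hp hq hl zr kE).
split.
- by rewrite NE; apply: eq_bigr => z uz; rewrite pA_div_gcd.
(* The summation bounds are moved into the condition, because [zrange] needs [z <= n %/ l] besides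
   the divisibility. *)
- rewrite NE natr_sum big_nat_cond [RHS]big_nat_cond; apply: eq_bigr => z.
  rewrite /= ltnS => /andP[zn uz]; have zr : zrange p q l n z by [].
  have [k kE] := two_variables_excess hp hq uz.
  by rewrite (pA_excess hp hq uz kE) (Mz_excess hp hq hl zr kE) addrC subrK.
- apply/seteqP; split=> [_ [[[x y] z] sol <-]|].
    have [zr tz] := (solutions3_slice _ _ _ _ _ _ hl).1 sol.
    by exists z => //; rewrite slice //; exists (x, y, z).
  move=> r [z zr]; rewrite slice // => -[[[x y] _] /= [tz ->] <-].
  by exists (x, y, z) => //; apply/solutions3_slice.
- move=> z zr res0; have [k kE] := two_variables_excess hp hq (proj2 zr).
  have none := solutions2_residue_lt0 hp hq hl zr kE res0.
  split=> [x y /(solutions3_slice _ _ _ _ _ _ hl)[_] /none //|].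
  by rewrite slice //; apply/seteqP; split=> // r [[[x y] z'] [/none]].
Qed.
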